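(* Let $G$ be a finite simple bipartite graph without isolated vertices that admits a nested ear decomposition. Then the number of even length ears in any nested ear decomposition of $G$ is equal to $\varphi(G)$, the minimum number of even length ears in any ear decomposition of $G$.
   Context: An ear decomposition of a graph $G$ is a collection of subgraphs $\mathcal{P}_0,\mathcal{P}_1,\dots,\mathcal{P}_r$ with $r>0$, whose edge sets form a partition of the edge set $E_G$, such that $\mathcal{P}_0$ is a single vertex and, for all $1\le i\le r$, $\mathcal{P}_i$ is a path (with at least one edge) whose end-vertices belong to $\mathcal{P}_0\cup\cdots\cup\mathcal{P}_{i-1}$ and none of whose inner vertices belongs to $\mathcal{P}_0\cup\cdots\cup\mathcal{P}_{i-1}$. The two end-vertices of a path $\mathcal{P}_i$ are allowed to coincide (as is necessarily the case for $\mathcal{P}_1$), in which case $\mathcal{P}_i$ is a cycle with a marked vertex; otherwise vertices are not repeated. The paths $\mathcal{P}_1,\dots,\mathcal{P}_r$ are called the ears; the length of an ear is its number of edges. $\varphi(G)$ denotes the minimum number of even length ears over all ear decompositions of $G$. If $\mathcal{P}_i$ has both its end-vertices in $\mathcal{P}_j$, we say that $\mathcal{P}_i$ is nested in $\mathcal{P}_j$, and the corresponding nest interval is the subpath of $\mathcal{P}_j$ determined by the end-vertices of $\mathcal{P}_i$. (A closed $\mathcal{P}_j$ is regarded as a path starting and finishing at its marked vertex; if an end-vertex of $\mathcal{P}_i$ is this marked vertex, it may be read as either end of $\mathcal{P}_j$, and the nest interval is chosen accordingly.) An ear decomposition is nested if, for all $1\le i\le r$, $\mathcal{P}_i$ is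 nested in some $\mathcal{P}_j$ with $j<i$ and, in addition, whenever two paths $\mathcal{P}_i$ and $\mathcal{P}_l$ are nested in $\mathcal{P}_j$, the corresponding nest intervals in $\mathcal{P}_j$ either have disjoint edge sets or one is contained in the other. *)

(* Defs.v *)
From mathcomp Require Import all_boot.
From mathcomp Require Import boolp.

Set Implicit Arguments.
Unset Strict Implicit.
Unset Printing Implicit Defensive.

Section Graph.
Variables (V : finType) (e : rel V).

Definition bipartite : Prop :=
  exists c : V -> bool, forall x y, e x y -> c x != c y.

Definition no_isolated_vertex : Prop := forall x, exists y, e x y.

Definition graph_edges : {set {set V}} :=
  [set [set xy.1; xy.2] | xy : V * V & e xy.1 xy.2].

End Graph.

(* [(x, s)] is the walk visiting the vertices of [x :: s] in this order; it has
   [size s] edges. *)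
Definition walk (V : finType) : Type := (V * seq V)%type.

Section Walk.
Variable V : finType.
Implicit Types (p q : walk V) (e : rel V).

Definition start p : V := p.1.
Definition finish p : V := last p.1 p.2.
Definition wlength p : nat := size p.2.
Definition vertices p : seq V := p.1 :: p.2.
Definition inner_vertices p : seq V := behead (belast p.1 p.2).

Definition edge_seq p : seq {set V} :=
  pairmap (fun x y => [set x; y]) p.1 p.2.
Definition edges p : {set {set V}} := [set:: edge_seq p].

(* Edges of the part of [q] between its [a]-th and [b]-th vertices (counted
   from 0): the [k]-th edge joins the [k]-th and [k.+1]-th vertices. *)
Definition subwalk_edges q (a b : nat) : {set {set V}} :=
  [set:: drop a (take b (edge_seq q))].

Definition is_path e p : bool := path e p.1 p.2 && uniq (vertices p).

(* The marked vertex of the cycle is [start p = finish p]. The bound on the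
   length rules out the walk [x, y, x], which traverses one edge twice. *)
Definition is_cycle e p : bool :=
  [&& path e p.1 p.2, finish p == start p, uniq p.2 & 2 < wlength p].

Definition is_ear e p : bool :=
  (0 < wlength p) && (is_path e p || is_cycle e p).

Definition nested_in p q : bool :=
  (start p \in vertices q) && (finish p \in vertices q).

(* [I] is the edge set of a nest interval of [p] in [q]. The positions [a] and
   [b] are determined by the end-vertices of [p], except that the marked vertex
   of a closed [q] has both positions [0] and [wlength q]. *)
Definition is_nest_interval p q (I : {set {set V}}) : Prop :=
  exists a b : nat,
    let x := nth (start q) (vertices q) a in
    let y := nth (start q) (vertices q) b in
    [/\ a <= b <= wlength q,
        (x = start p /\ y = finish p) \/ (x = finish p /\ y = start p) &
        I = subwalk_edges q a b].

End Walk.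

(* A sequence P_0, ..., P_r is given by [r] and [P : nat -> walk V]; the values
   of [P] beyond [r] are irrelevant. *)
Section EarDecomposition.
Variables (V : finType) (e : rel V).
Implicit Types (r : nat) (P : nat -> walk V).

Definition vertex_before P (i : nat) (x : V) : Prop :=
  exists2 j, j < i & x \in vertices (P j).

Definition ear_decomposition r P : Prop :=
  [/\ 0 < r,
      wlength (P 0) = 0,
      forall i, 1 <= i <= r ->
        [/\ is_ear e (P i),
            vertex_before P i (start (P i)),
            vertex_before P i (finish (P i)) &
            forall x, x \in inner_vertices (P i) -> ~ vertex_before P i x],
      forall i j, i <= r -> j <= r -> i != j ->
        [disjoint edges (P i) & edges (P j)] &
      \bigcup_(i < r.+1) edges (P i) = graph_edges e].

Definition nested_ear_decomposition r P : Prop :=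
  [/\ ear_decomposition r P,
      forall i, 1 <= i <= r -> exists2 j, j < i & nested_in (P i) (P j) &
      exists I : nat -> nat -> {set {set V}},
        (forall i j, 1 <= i <= r -> j <= r -> nested_in (P i) (P j) ->
           is_nest_interval (P i) (P j) (I i j)) /\
        (forall i l j, 1 <= i <= r -> 1 <= l <= r -> j <= r ->
           nested_in (P i) (P j) -> nested_in (P l) (P j) ->
           [\/ [disjoint I i j & I l j], I i j \subset I l j |
               I l j \subset I i j])].

Definition even_ears r P : nat :=
  \sum_(1 <= i < r.+1 | ~~ odd (wlength (P i))) 1.

Definition attained_even_ears (n : nat) : Prop :=
  exists r P, ear_decomposition r P /\ even_ears r P = n.

(* The value is 0 by convention when there is no ear decomposition. *)
Definition phi : nat :=
  if pselect (exists n, `[< attained_even_ears n >]) is left h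
  then ex_minn h else 0.

End EarDecomposition.

(* Main.v *)
Require Import Defs.
From mathcomp Require Import all_boot zify.
From mathcomp Require Import boolp.

Set Implicit Arguments.
Unset Strict Implicit.
Unset Printing Implicit Defensive.

(** Idea.  Colour the edges of every ear of the nested decomposition alternately,
    starting with white, and let [J] be the set of black edges: it contains half
    of each ear, rounded down.  Every even subgraph [C] has at most half of its
    edges in [J].  Indeed, among the ears used by [C], take one whose parent ear
    has maximal index and then one whose nest interval is shortest.  Then [C]
    contains this whole ear, and contains its nest interval or avoids it.
    By bipartiteness the ear and the interval have the same parity, so replacing
    one by the other (modulo 2) does not increase white minus black.

    On the other hand, for an arbitrary ear decomposition any edge set, in
    particular [J], can be changed by an even subgraph so as to contain at most
    half of each ear: treat the ears from last to first, adding if needed a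
    cycle through the ear and earlier ones.  Hence the sum of [l./2] over the ear
    lengths [l] is minimal for the nested decomposition; since [l - 1] sums
    to [#|V| - 1] for every decomposition, the number of even ears is
    [2 * sum l./2 - #|V| + 1] and is minimal as well. *)

(** * Addition of sets modulo 2 *)

Section SymmetricDifference.
Variable T : finType.
Implicit Types A B C : {set T}.

Definition symdiff A B : {set T} := [set x | (x \in A) (+) (x \in B)].

Lemma in_symdiff A B x : (x \in symdiff A B) = (x \in A) (+) (x \in B).
Proof. by rewrite inE. Qed.

Lemma card_symdiff A B : #|symdiff A B| + (#|A :&: B|).*2 = #|A| + #|B|.
Proof.
have -> : symdiff A B = (A :\: B) :|: (B :\: A).
  by apply/setP => x; rewrite !inE; case: (x \in A); case: (x \in B).
rewrite -(cardsID B A) -(cardsID A B) (setIC B A) cardsU.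
have -> : (A :\: B) :&: (B :\: A) = set0.
  by apply/setP => x; rewrite !inE; case: (x \in A); case: (x \in B).
rewrite cards0; lia.
Qed.

Lemma symdiffIl A B C : symdiff A B :&: C = symdiff (A :&: C) (B :&: C).
Proof. by apply/setP => x; rewrite !inE; case: (x \in C); rewrite ?andbT ?andbF. Qed.

Lemma symdiffA A B C : symdiff A (symdiff B C) = symdiff (symdiff A B) C.
Proof. by apply/setP => x; rewrite !inE addbA. Qed.

Lemma symdiffxx A : symdiff A A = set0.
Proof. by apply/setP => x; rewrite !inE addbb. Qed.

Lemma symdiff0 A : symdiff A set0 = A.
Proof. by apply/setP => x; rewrite !inE addbF. Qed.

(** Adding [A] to [C] modulo 2 removes it, while adding [B] either gains it or loses it as well. It
    is applied with [K] full, for sizes, and with [K] the black edges. *)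
Lemma card_exchange C A B K (D := symdiff C (symdiff A B)) :
  A \subset C -> [disjoint A & B] ->
  ([disjoint C & B] -> #|D :&: K| + #|A :&: K| = #|C :&: K| + #|B :&: K|) /\
  (B \subset C -> #|D :&: K| + #|A :&: K| + #|B :&: K| = #|C :&: K|).
Proof.
move=> AC AB; rewrite /D symdiffA.
have := card_symdiff (C :&: K) (A :&: K).
rewrite -symdiffIl setIACA (setIidPr AC) setIid => eq1.
have := card_symdiff (symdiff C A :&: K) (B :&: K).
rewrite -symdiffIl setIACA setIid.
rewrite (symdiffIl C A B) (disjoint_setI0 AB) symdiff0 => eq2.
split=> [/disjoint_setI0 CB | /setIidPr CB]; move: eq2; rewrite CB ?set0I ?cards0; lia.
Qed.

End SymmetricDifference.

(** * Vertex degrees modulo 2 and even subgraphs *)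

Section DegreeParity.
Variable V : finType.
Implicit Types C D : {set {set V}}.

Definition odd_degree C (v : V) : bool := odd #|[set f in C | v \in f]|.
Definition even_subgraph C : Prop := forall v, odd_degree C v = false.

Lemma odd_degree0 v : odd_degree set0 v = false.
Proof. by rewrite /odd_degree eq_card0 // => f; rewrite !inE. Qed.

Lemma odd_degree_symdiff C D v :
  odd_degree (symdiff C D) v = odd_degree C v (+) odd_degree D v.
Proof.
rewrite /odd_degree.
have E (A : {set {set V}}) : [set f in A | v \in f] = A :&: [set f : {set V} | v \in f].
  by apply/setP => f; rewrite !inE.
rewrite !E symdiffIl -oddD -card_symdiff; lia.
Qed.

End DegreeParity.

(** * Walks and ears described by positions *)

Section Walks.
Variable V : finType.
Implicit Types (p q : walk V) (e : rel V).

(** Positions keep apart the two readings of the marked vertex of a closed walk. The body is the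
    expression occurring in [is_nest_interval]. *)
Definition vtx q (k : nat) : V := nth (start q) (vertices q) k.
Definition edg q (k : nat) : {set V} := [set vtx q k; vtx q k.+1].

Lemma vtx0 q : vtx q 0 = start q.
Proof. by []. Qed.

Lemma vtx_wlength q : vtx q (wlength q) = finish q.
Proof. by rewrite /vtx /wlength /finish /vertices -nth_last; case: q.2. Qed.

Lemma mem_vtx q k : k <= wlength q -> vtx q k \in vertices q.
Proof. by move=> lk; apply: mem_nth. Qed.

Lemma vtxP q x : reflect (exists2 k, k <= wlength q & x = vtx q k) (x \in vertices q).
Proof.
apply: (iffP idP) => [xq | [k lk ->]]; last exact: mem_vtx.
by exists (index x (vertices q)); rewrite /vtx ?nth_index // -ltnS; move: xq; rewrite -index_mem.
Qed.

Lemma inner_verticesE q :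
  inner_vertices q = [seq vtx q k | k <- index_iota 1 (wlength q)].
Proof.
rewrite /index_iota /inner_vertices /vtx /vertices /wlength; case: q => x s /=.
apply: (@eq_from_nth _ x) => [|k].
  by rewrite size_map size_iota size_behead size_belast subn1.
rewrite size_behead size_belast => lk.
rewrite (nth_map 0) ?size_iota ?nth_iota ?subn1 // nth_behead add1n.
by rewrite lastI nth_rcons size_belast -ltn_predRL lk.
Qed.

Lemma inner_verticesP q x :
  reflect (exists2 k, 0 < k < wlength q & x = vtx q k) (x \in inner_vertices q).
Proof.
rewrite inner_verticesE; apply: (iffP mapP) => -[k].
  by rewrite mem_index_iota => lk ->; exists k.
by move=> lk ->; exists k; rewrite ?mem_index_iota.
Qed.

Lemma edge_seqE q : edge_seq q = [seq edg q k | k <- iota 0 (wlength q)].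
Proof.
apply: (@eq_from_nth _ set0) => [|k].
  by rewrite size_map size_iota size_pairmap.
rewrite size_pairmap => lk.
by rewrite (nth_pairmap q.1) // (nth_map 0) ?size_iota ?nth_iota.
Qed.

Lemma subwalk_edgesE q a b : b <= wlength q ->
  subwalk_edges q a b = [set:: [seq edg q k | k <- index_iota a b]].
Proof.
move=> lb; rewrite /subwalk_edges edge_seqE -map_take -map_drop take_iota.
by rewrite drop_iota (minn_idPl lb).
Qed.

Lemma edgesE q : edges q = subwalk_edges q 0 (wlength q).
Proof. by rewrite /subwalk_edges drop0 take_oversize // size_pairmap. Qed.

Lemma subwalk_edgesP q a b f : b <= wlength q ->
  reflect (exists2 k, a <= k < b & f = edg q k) (f \in subwalk_edges q a b).
Proof.
move=> lb; rewrite subwalk_edgesE // inE; apply: (iffP mapP) => -[k].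
  by rewrite mem_index_iota => lk ->; exists k.
by move=> lk ->; exists k; rewrite ?mem_index_iota.
Qed.

Lemma edgesP q f :
  reflect (exists2 k, k < wlength q & f = edg q k) (f \in edges q).
Proof. by rewrite edgesE; apply: (iffP (subwalk_edgesP _ _ _)). Qed.

Lemma subwalk_edges_sub q a b : subwalk_edges q a b \subset edges q.
Proof.
apply/subsetP => f; rewrite !inE => /mem_drop; exact: mem_take.
Qed.

Lemma ear_edge e q k : is_ear e q -> k < wlength q -> e (vtx q k) (vtx q k.+1).
Proof.
move=> /andP[_ /orP[/andP[+ _] | /and4P[+ _ _ _]]] lk.
  by move=> /(pathP (start q))/(_ k lk).
by move=> /(pathP (start q))/(_ k lk).
Qed.

Lemma ear_vtx_inj e q a b : is_ear e q -> vtx q a = vtx q b ->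
  a < b <= wlength q -> a = 0 /\ b = wlength q /\ 2 < wlength q.
Proof.
move=> /andP[_ /orP[/andP[_ uq] | /and4P[_ /eqP fin uq l3]]] E /andP[ab lb].
  suff: a = b by lia.
  have la : a < (wlength q).+1 by lia.
  by apply/eqP; rewrite -(nth_uniq (start q) (la : a < size (vertices q)) lb uq); apply/eqP.
have inj i j : 0 < i <= wlength q -> 0 < j <= wlength q ->
    vtx q i = vtx q j -> i = j.
  case: i j => [|i] [|j] // /andP[_ li] /andP[_ lj] Eij.
  by congr S; apply/eqP; rewrite -(nth_uniq (start q) li lj uq); apply/eqP.
case: a => [|a] in E ab *; last first.
  suff: a.+1 = b by lia.
  by apply: inj => //; lia.
split=> //; split=> //; move: E; rewrite vtx0 -fin -vtx_wlength => E.
by symmetry; apply: inj => //; lia.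
Qed.

(** By [ear_vtx_inj], a repeated edge forces a closed walk of length 2, which the length bound on
    cycles excludes. *)
Lemma ear_edg_inj e q i j : is_ear e q -> i < wlength q -> j < wlength q ->
  edg q i = edg q j -> i = j.
Proof.
move=> ear; wlog ij : i j / i <= j.
  by case: (leqP i j) => [/[swap] H | /ltnW /[swap] H] ? ? ? ?; [|symmetry]; apply: H.
move=> li lj E; apply/eqP; rewrite eqn_leq ij leqNgt; apply/negP => ij'.
have: vtx q i.+1 \in edg q j by rewrite -E set22.
have: vtx q i \in edg q j by rewrite -E set21.
rewrite !inE => /orP[] /eqP/(ear_vtx_inj ear); first by lia.
by move=> H /orP[] /eqP/(ear_vtx_inj ear); lia.
Qed.

Lemma ear_edge_uniq e q a b : is_ear e q -> b <= wlength q ->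
  uniq [seq edg q k | k <- index_iota a b].
Proof.
move=> ear lb; rewrite map_inj_in_uniq ?iota_uniq // => i j.
by rewrite !mem_index_iota => li lj; apply: (ear_edg_inj ear); lia.
Qed.

(** Lengths, degrees and numbers of black edges along an interval are all counted by instances of
    this sum. *)
Lemma card_subwalk e q a b (Q : pred {set V}) :
  is_ear e q -> b <= wlength q ->
  #|[set f in subwalk_edges q a b | Q f]| = \sum_(a <= k < b) Q (edg q k).
Proof.
move=> ear lb; rewrite subwalk_edgesE //.
set s := [seq _ | _ <- _].
have -> : [set f in [set:: s] | Q f] = [set:: [seq f <- s | Q f]].
  by apply/setP => f; rewrite !inE mem_filter andbC.
have /card_uniqP us : uniq [seq f <- s | Q f].
  exact/filter_uniq/(ear_edge_uniq _ ear).
rewrite cardsE us size_filter /s count_map -sum1_count big_mkcond /=.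
by apply: eq_bigr => k _; case: ifP.
Qed.

Lemma card_subwalk_edges e q a b : is_ear e q -> b <= wlength q ->
  #|subwalk_edges q a b| = b - a.
Proof.
move=> ear lb; rewrite -[RHS]muln1 -sum_nat_const_nat -(card_subwalk a xpredT ear lb).
by congr #|pred_of_set _|; apply/setP => f; rewrite inE andbT.
Qed.

Lemma mem_subwalk e q a b k : is_ear e q -> b <= wlength q -> k < wlength q ->
  (edg q k \in subwalk_edges q a b) = (a <= k < b).
Proof.
move=> ear lb lk; apply/(subwalk_edgesP _ _ lb)/idP => [[m lm E]|]; last by exists k.
by rewrite (ear_edg_inj ear lk _ E) //; lia.
Qed.

Lemma inner_vtx_inj e q k m : is_ear e q -> 0 < k < wlength q -> m <= wlength q ->
  vtx q k = vtx q m -> k = m.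
Proof.
move=> ear lk lm E; case: (ltngtP k m) => // km.
  by have := ear_vtx_inj ear E; lia.
by have := ear_vtx_inj ear (esym E); lia.
Qed.

(* Of the two edges at [vtx q k], both lie in the first interval and only one in
   the second. *)
Lemma subwalks_cross e q a b c d k : is_ear e q ->
  a < k < b -> b <= wlength q -> c <= d <= wlength q -> b - a <= d - c ->
  vtx q k = vtx q c \/ vtx q k = vtx q d ->
  ~ [\/ [disjoint subwalk_edges q a b & subwalk_edges q c d],
        subwalk_edges q a b \subset subwalk_edges q c d |
        subwalk_edges q c d \subset subwalk_edges q a b].
Proof.
move=> ear lk lb /andP[cd ld] le kcd.
have {}kcd : k = c \/ k = d.
  by case: kcd => E; [left|right]; apply: (inner_vtx_inj ear _ _ E); lia.
have mem_ab m : m < wlength q -> _ := @mem_subwalk e q a b m ear lb.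
have mem_cd m : m < wlength q -> _ := @mem_subwalk e q c d m ear ld.
have k_w : k < wlength q by lia.
have k1_w : k.-1 < wlength q by lia.
have k_ab : edg q k \in subwalk_edges q a b by rewrite mem_ab; lia.
have k1_ab : edg q k.-1 \in subwalk_edges q a b by rewrite mem_ab; lia.
have not_sub : ~ subwalk_edges q a b \subset subwalk_edges q c d.
  move=> /subsetP sub; have := sub _ k_ab; have := sub _ k1_ab.
  by rewrite !mem_cd //; lia.
case=> [dis | // | sub].
  have := disjointFr dis k_ab; have := disjointFr dis k1_ab.
  by rewrite !mem_cd //; lia.
(* The second interval is at least as long, so its inclusion in the first would be an equality. *)
apply: not_sub; suff /eqP <- : subwalk_edges q c d == subwalk_edges q a b by [].
by rewrite eqEcard sub !(card_subwalk_edges _ ear).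
Qed.

Lemma mem_edg q v k : vtx q k != vtx q k.+1 ->
  (v \in edg q k) = (v == vtx q k) (+) (v == vtx q k.+1).
Proof.
move=> ne; rewrite !inE; case: (v =P vtx q k) => // vk.
by rewrite vk (negPf ne).
Qed.

Lemma ear_vtx_neq e q k : is_ear e q -> k < wlength q -> vtx q k != vtx q k.+1.
Proof. by move=> ear lk; apply/eqP => /(ear_vtx_inj ear); lia. Qed.

(** The contributions of consecutive edges telescope modulo 2; for a whole closed ear the two
    remaining terms cancel. *)
Lemma odd_degree_subwalk e q a b v : is_ear e q -> a <= b <= wlength q ->
  odd_degree (subwalk_edges q a b) v = (v == vtx q a) (+) (v == vtx q b).
Proof.
move=> ear /andP[ab lb]; rewrite /odd_degree (card_subwalk a _ ear lb).
rewrite -(subnKC ab) in lb *; elim: (b - a) lb => [|n IH] lb.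
  by rewrite addn0 big_geq // addbb.
rewrite addnS big_nat_recr /= ?leq_addr // oddD IH ?oddb; last by lia.
rewrite mem_edg; last by apply: (ear_vtx_neq ear); lia.
by rewrite -!addbA addKb.
Qed.

Lemma sum_odd n : \sum_(0 <= k < n) (odd k : nat) = n./2.
Proof. by elim: n => [|n IH]; [rewrite big_geq | rewrite big_nat_recr //= IH; lia]. Qed.

(** Each edge switches the colour, so the parity of a length depends only on the two ends. *)
Lemma bip_parity e (c : V -> bool) q a b :
  (forall x y, e x y -> c x != c y) -> is_ear e q -> a <= b <= wlength q ->
  odd (b - a) = c (vtx q a) (+) c (vtx q b).
Proof.
move=> hc ear /andP[ab]; rewrite -{1 3}(subnKC ab).
elim: (b - a) => [|n IH] lb; first by rewrite addn0 addbb.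
have /hc : e (vtx q (a + n)) (vtx q (a + n).+1) by apply: (ear_edge ear); lia.
rewrite addnS /= IH; last by lia.
by case: (c _); case: (c _); case: (c _).
Qed.

End Walks.

(** * Counting in an arbitrary ear decomposition, and correcting edge sets by even subgraphs *)

Section EarDecompositions.
Variables (V : finType) (e : rel V) (r : nat) (P : nat -> walk V).
Hypothesis dec : ear_decomposition e r P.

Lemma dec_ear i : 0 < i <= r -> is_ear e (P i).
Proof. by case: dec => _ _ H _ _ /H[]. Qed.

Lemma dec_root : vertices (P 0) = [:: start (P 0)].
Proof. by case: dec => _; rewrite /wlength /vertices /start; case: (P 0) => x []. Qed.

Lemma dec_edges0 : edges (P 0) = set0.
Proof. by apply/setP => f; rewrite in_set0; apply/negP => /edgesP[k]; case: dec => _ ->. Qed.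

Lemma dec_inner i j k : 0 < i <= r -> j < i -> 0 < k < wlength (P i) ->
  vtx (P i) k \notin vertices (P j).
Proof.
case: dec => _ _ H _ _ /H[_ _ _ inn] ji lk; apply/negP => vj.
apply: (inn (vtx (P i) k)); last by exists j.
by apply/inner_verticesP; exists k.
Qed.

Lemma dec_ends i x : 0 < i <= r -> x = start (P i) \/ x = finish (P i) ->
  exists2 j, j < i & x \in vertices (P j).
Proof. by case: dec => _ _ H _ _ /H[_ ? ? _] [->|->]. Qed.

Lemma dec_edges_disjoint i j f :
  i <= r -> j <= r -> f \in edges (P i) -> f \in edges (P j) -> i = j.
Proof.
case: dec => _ _ _ H _ ir jr fi fj; apply/eqP/negPn/negP => ij.
by have /disjointFr/(_ fi) := H i j ir jr ij; rewrite fj.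
Qed.

Lemma dec_edges_setI0 i j : i <= r -> j <= r -> i != j ->
  edges (P i) :&: edges (P j) = set0.
Proof. by case: dec => _ _ _ H _ ir jr ij; apply/disjoint_setI0/H. Qed.

Lemma dec_edge_cover f : f \in graph_edges e -> exists2 i, 0 < i <= r & f \in edges (P i).
Proof.
case: dec => _ _ _ _ <- /bigcupP[i _ fi]; exists i => //.
by rewrite -[_ <= r]ltnS ltn_ord andbT lt0n; apply: contraTneq fi => ->; rewrite dec_edges0 inE.
Qed.

Lemma dec_edges_sub i : i <= r -> edges (P i) \subset graph_edges e.
Proof.
by case: dec => _ _ _ _ <- ir; apply: (bigcup_max (Ordinal (ir : i < r.+1))).
Qed.

Lemma card_dec (K : {set {set V}}) : K \subset graph_edges e ->
  #|K| = \sum_(1 <= i < r.+1) #|K :&: edges (P i)|.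
Proof.
move=> KE; rewrite [in LHS](_ : K = \bigcup_(i < r.+1) (K :&: edges (P i))); last first.
  by case: dec => _ _ _ _ E; rewrite -big_distrr /= E (setIidPl KE).
rewrite -sum1_card partition_disjoint_bigcup /=; last first.
  move=> i j ij; rewrite disjoints_subset; apply/subsetP => f.
  rewrite in_setC !in_setI => /andP[_ fi]; rewrite negb_and; apply/orP; right.
  apply: contraNN ij => fj.
  apply/eqP/val_inj; apply: (dec_edges_disjoint _ _ fi fj); rewrite -ltnS //.
rewrite -(big_mkord xpredT (fun i => \sum_(x in K :&: edges (P i)) 1)).
rewrite big_ltn // dec_edges0 setI0 big_set0 add0n.
by apply: eq_bigr => i _; rewrite sum1_card.
Qed.

(** An ear of length [l] contributes exactly its [l - 1] inner vertices: these are new and distinct,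
    while its ends occur earlier. *)
Lemma card_dec_vertices m : m <= r ->
  #|\bigcup_(j < m.+1) [set:: vertices (P j)]| = (\sum_(1 <= i < m.+1) (wlength (P i)).-1).+1.
Proof.
elim: m => [|m IH] mr.
  rewrite big_ord1 big_geq // dec_root -(cards1 (start (P 0))).
  by apply: eq_card => x; rewrite !inE.
have ear : is_ear e (P m.+1) by apply: dec_ear.
rewrite big_ord_recr big_nat_recr //= -addSn -IH; last by lia.
set U := \bigcup_(j < m.+1) _.
have -> : U :|: [set:: vertices (P m.+1)] = U :|: [set:: inner_vertices (P m.+1)].
  apply/setP => x; rewrite !in_setU; case xU: (x \in U) => //=; rewrite 2!in_set.
  apply/idP/idP => /=; last first.
    by case/inner_verticesP => k lk ->; apply: mem_vtx; lia.
  case/vtxP => k lk xk; apply/inner_verticesP; exists k => //.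
  suff: ~ (k = 0 \/ k = wlength (P m.+1)) by lia.
  move=> ends; have [j jm xj]: exists2 j, j < m.+1 & x \in vertices (P j).
    apply: (@dec_ends m.+1) => //; rewrite xk.
    by case: ends => ->; [left|right; rewrite vtx_wlength].
  by case/bigcupP: xU; exists (Ordinal jm) => //; rewrite inE.
rewrite cardsU (_ : U :&: _ = set0) ?cards0 ?subn0; last first.
  apply/setP => x; rewrite !inE; apply/negP => /andP[/bigcupP[j _]]; rewrite inE => xj.
  by case/inner_verticesP => k lk xk; move: xj; rewrite xk; apply/negP/dec_inner.
congr addn; rewrite cardsE inner_verticesE; apply/eqP.
set s := [seq _ | _ <- _].
have /card_uniqP -> : uniq s.
  rewrite map_inj_in_uniq ?iota_uniq // => i j; rewrite !mem_index_iota => li lj E.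
  by case: (ltngtP i j) => // ij;
    [have := ear_vtx_inj ear E | have := ear_vtx_inj ear (esym E)]; lia.
by rewrite size_map size_iota subn1.
Qed.

Lemma card_vertices : irreflexive e -> no_isolated_vertex e ->
  #|V| = (\sum_(1 <= i < r.+1) (wlength (P i)).-1).+1.
Proof.
move=> irr noiso; rewrite -card_dec_vertices // -cardsT; apply: eq_card => x.
rewrite inE; have [y xy] := noiso x.
have /dec_edge_cover[i ir] : [set x; y] \in graph_edges e.
  by apply/imsetP; exists (x, y); rewrite ?inE.
case/edgesP => k lk E; symmetry; apply/bigcupP.
have ir' : i < r.+1 by lia.
exists (Ordinal ir') => //; rewrite inE /=.
have : x \in edg (P i) k by rewrite -E set21.
by rewrite !inE => /orP[]/eqP ->; apply: mem_vtx; lia.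
Qed.

(** For [l > 0], twice [l./2] is [l - 1], plus 1 exactly when [l] is even; [card_vertices] evaluates
    the sum of the terms [l - 1]. *)
Lemma sum_wlength_even_ears : irreflexive e -> no_isolated_vertex e ->
  (\sum_(1 <= i < r.+1) (wlength (P i))./2).*2.+1 = #|V| + even_ears r P.
Proof.
move=> irr noiso; rewrite (card_vertices irr noiso) addSn; congr S.
rewrite -addnn -big_split /=.
rewrite /even_ears [X in _ + X]big_mkcond -big_split /=; apply: eq_big_nat => i ir.
by have /andP[l0 _] := dec_ear ir; case: ifP; lia.
Qed.

(** Both ends of the ear are linked to the root through earlier ears. Adding the ear to the two
    links modulo 2 makes all degrees even, and the links avoid the ear itself. *)
Lemma ear_cycle i : 0 < i <= r ->
  exists C : {set {set V}}, [/\ C \subset graph_edges e, even_subgraph C,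
    edges (P i) \subset C & forall k, i < k <= r -> [disjoint C & edges (P k)]].
Proof.
(* The link follows [P j] from [x] back to its start, which lies on an earlier walk, and recurses;
   [m] only bounds [j] for the induction. *)
have reach m : forall j x, j < m -> j <= r -> x \in vertices (P j) ->
   exists F : {set {set V}}, [/\ F \subset graph_edges e,
      forall k, j < k <= r -> [disjoint F & edges (P k)] &
      forall v, odd_degree F v = (v == start (P 0)) (+) (v == x)].
  elim: m => // m IH j x jm jr.
  case: (posnP j) => [-> | j0].
    rewrite dec_root inE => /eqP ->; exists set0; split.
    - exact: sub0set.
    - by move=> k _; rewrite -setI_eq0 set0I.
    - by move=> v; rewrite addbb odd_degree0.
  case/vtxP => a la ->.
  have jr' : 0 < j <= r by rewrite j0.
  have ear := dec_ear jr'.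
  have [j' j'j sj'] := dec_ends jr' (or_introl (erefl (start (P j)))).
  have [||F [FE Fk Fd]] := IH j' (start (P j)) _ _ sj'; try lia.
  exists (symdiff F (subwalk_edges (P j) 0 a)); split.
  - apply/subsetP => f; rewrite in_symdiff; case fF: (f \in F); first by rewrite (subsetP FE).
    move=> /= /(subsetP (subwalk_edges_sub _ _ _)) fj.
    exact: (subsetP (dec_edges_sub jr)).
  - move=> k lk; rewrite disjoint_sym disjoints_subset; apply/subsetP => f fk.
    rewrite in_setC in_symdiff (disjointFl (Fk k _) fk) /=; last by lia.
    apply/negP => /(subsetP (subwalk_edges_sub _ _ _)) fj.
    by have := dec_edges_disjoint _ jr fk fj; lia.
  - by move=> v; rewrite odd_degree_symdiff Fd (odd_degree_subwalk _ ear) ?la // vtx0 addbA addbK.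
move=> ir; have ear := dec_ear ir.
have [j ji xj] := dec_ends ir (or_introl (erefl (start (P i)))).
have [j' j'i xj'] := dec_ends ir (or_intror (erefl (finish (P i)))).
have [||F [FE Fk Fd]] := reach j.+1 j _ _ _ xj; try lia.
have [||F' [FE' Fk' Fd']] := reach j'.+1 j' _ _ _ xj'; try lia.
have FG k f : i <= k <= r -> f \in edges (P k) -> f \in symdiff F F' = false.
  by move=> lk fk; rewrite in_symdiff (disjointFl (Fk k _) fk) ?(disjointFl (Fk' k _) fk) //; lia.
exists (symdiff (symdiff F F') (edges (P i))); split.
- apply/subsetP => f; rewrite in_symdiff; case fP: (f \in edges _).
    by move=> _; apply: (subsetP (dec_edges_sub _) _ fP); lia.
  rewrite addbF in_symdiff; case fF: (f \in F); first by rewrite (subsetP FE).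
  exact: (subsetP FE').
- move=> v; rewrite !odd_degree_symdiff Fd Fd' edgesE (odd_degree_subwalk _ ear) ?leqnn //.
  by rewrite vtx0 vtx_wlength; do ! case: (_ == _).
- by apply/subsetP => f fi; rewrite in_symdiff fi (FG i) //; lia.
- move=> k lk; rewrite disjoint_sym disjoints_subset; apply/subsetP => f fk.
  rewrite in_setC in_symdiff (FG k f _ fk) /=; last by lia.
  by apply/negP => fi; have := dec_edges_disjoint _ _ fk fi; lia.
Qed.

(** Ear [m] is corrected first, by a subgraph that may disturb earlier ears but no later one. The
    induction therefore runs over all [K]. *)
Lemma shift_to_minority (K : {set {set V}}) m : m <= r ->
  exists D : {set {set V}}, [/\ D \subset graph_edges e, even_subgraph D,
    forall k, m < k <= r -> [disjoint D & edges (P k)] &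
    forall i, 0 < i <= m ->
      (#|symdiff K D :&: edges (P i)|).*2 <= wlength (P i)].
Proof.
elim: m K => [|m IH] K mr.
  exists set0; split; rewrite ?sub0set //.
  - exact: odd_degree0.
  - by move=> k _; rewrite -setI_eq0 set0I.
  - by move=> i; lia.
have ir : 0 < m.+1 <= r by [].
have [C [CE Ceven Ck CK]] : exists C : {set {set V}}, [/\ C \subset graph_edges e,
    even_subgraph C, forall k, m.+1 < k <= r -> [disjoint C & edges (P k)] &
    (#|symdiff K C :&: edges (P m.+1)|).*2 <= wlength (P m.+1)].
  case: (leqP (#|K :&: edges (P m.+1)|).*2 (wlength (P m.+1))) => [le|lt].
    exists set0; rewrite symdiff0; split; rewrite ?sub0set //.
      exact: odd_degree0.
    by move=> k _; rewrite -setI_eq0 set0I.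
  (* This even subgraph contains the whole ear, so adding it complements [K] there and turns a
     majority into a minority. *)
  have [C [CE Ceven Ci Ck]] := ear_cycle ir; exists C; split=> //.
  have -> : symdiff K C :&: edges (P m.+1) = edges (P m.+1) :\: K.
    apply/setP => f; rewrite in_setI in_setD in_symdiff.
    case fi: (f \in edges _); last by rewrite !andbF.
    by rewrite (subsetP Ci _ fi) !andbT addbT.
  have := cardsID K (edges (P m.+1)); rewrite setIC.
  rewrite {3}edgesE (card_subwalk_edges _ (dec_ear ir)) // subn0; lia.
have [|D [DE Deven Dk DK]] := IH (symdiff K C); first lia.
exists (symdiff C D); split.
- apply/subsetP => f; rewrite in_symdiff; case fC: (f \in C); first by rewrite (subsetP CE).
  exact: (subsetP DE).
- by move=> v; rewrite odd_degree_symdiff Ceven Deven.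
- move=> k lk; rewrite disjoint_sym disjoints_subset; apply/subsetP => f fk.
  by rewrite in_setC in_symdiff (disjointFl (Ck k _) fk) ?(disjointFl (Dk k _) fk) //; lia.
move=> i im; rewrite symdiffA; case: (ltnP i m.+1) => lim; first by apply: DK; lia.
have {im lim} -> : i = m.+1 by lia.
suff -> : symdiff (symdiff K C) D :&: edges (P m.+1) = symdiff K C :&: edges (P m.+1) by [].
apply/setP => f; rewrite !in_setI; case fi: (f \in edges _); rewrite ?andbF ?andbT //.
by rewrite [LHS]in_symdiff (disjointFl (Dk m.+1 _) fi) ?addbF // ltnSn.
Qed.

(** Adding an even subgraph [D] never shrinks [J], since at most half of [D] lies in [J]; choose [D]
    leaving at most half of each ear. *)
Lemma card_join_le (J : {set {set V}}) :
  J \subset graph_edges e ->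
  (forall C : {set {set V}}, C \subset graph_edges e -> even_subgraph C ->
     (#|C :&: J|).*2 <= #|C|) ->
  #|J| <= \sum_(1 <= i < r.+1) (wlength (P i))./2.
Proof.
move=> JE cons; have [D [DE Deven _ DP]] := shift_to_minority J (leqnn r).
have := card_symdiff J D; have := cons D DE Deven; rewrite setIC => le1 eq1.
apply: (@leq_trans #|symdiff J D|); first by lia.
rewrite card_dec; last first.
  apply/subsetP => f; rewrite in_symdiff; case fJ: (f \in J); first by rewrite (subsetP JE).
  exact: (subsetP DE).
by rewrite !big_nat; apply: leq_sum => i ir; have := DP i ir; lia.
Qed.

End EarDecompositions.

(** White minus black is 0 or 1 on an ear of length [l], according to parity. On an interval of the
    same parity its absolute value is the same, its sign depending on the colour of the first edge.
    The two bounds serve the cases where [C] avoids the interval or contains it. *)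
Lemma half_subn_bounds l a b : a <= b -> odd (b - a) = odd l ->
  (l./2).*2 + (b - a) <= l + (b./2 - a./2).*2 /\
  (l./2).*2 + (b./2 - a./2).*2 <= l + (b - a).
Proof.
move=> ab; rewrite oddB // => par.
have := odd_double_half a; have := odd_double_half b; have := odd_double_half l.
by rewrite -par; case: (odd a); case: (odd b); split; lia.
Qed.

(** At least [2 ^ i] is lost, and at most [2 ^ j] is gained. *)
Lemma sum_expn2_lt r (U U' : pred nat) i j : j < i <= r -> U i -> ~~ U' i ->
  (forall l, l <= r -> l != i -> l != j -> U' l -> U l) ->
  \sum_(l < r.+1 | U' l) 2 ^ l < \sum_(l < r.+1 | U l) 2 ^ l.
Proof.
move=> /andP[ji ir] Ui U'i sub; have jr : j <= r by lia.
have pow m : m <= r -> 2 ^ m = \sum_(l < r.+1) (if l == m :> nat then 2 ^ l else 0).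
  by move=> mr; rewrite -big_mkcond (big_pred1 (Ordinal (mr : m < r.+1))).
have lt2 : 2 ^ j < 2 ^ i by rewrite ltn_exp2l.
suff : \sum_(l < r.+1 | U' l) 2 ^ l + 2 ^ i <= \sum_(l < r.+1 | U l) 2 ^ l + 2 ^ j.
  by lia.
rewrite (pow i ir) (pow j jr).
rewrite (big_mkcond (fun l : 'I__ => U' l)) (big_mkcond (fun l : 'I__ => U l)) /=.
rewrite -!big_split; apply: leq_sum => -[l lr] _ /=.
case: (eqVneq l i) => [-> | li]; first by rewrite Ui (negPf U'i); lia.
case: (eqVneq l j) => [_ | lj]; first by case: (U' l); lia.
by have := sub l lr li lj; case: (U' l) => // ->.
Qed.

(** * The alternating colouring of a nested decomposition against even subgraphs *)

Section NestedEarDecompositions.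
Variables (V : finType) (e : rel V) (r : nat) (P : nat -> walk V).
Hypotheses (bip : bipartite e) (nest : nested_ear_decomposition e r P).

Let dec : ear_decomposition e r P.
Proof. by case: nest. Qed.

(* Edges of an ear are counted from 0, so an ear of length [l] gets [l./2] edges. *)
Definition alternating_join : {set {set V}} :=
  [set f | [exists i : 'I_r.+1, [exists k : 'I_(wlength (P i)),
    odd k && (f == edg (P i) k)]]].

Local Notation J := alternating_join.

Lemma edg_alternating i k : 0 < i <= r -> k < wlength (P i) ->
  (edg (P i) k \in J) = odd k.
Proof.
move=> ir lk; have ear := dec_ear dec ir; rewrite inE.
apply/existsP/idP => [[i' /existsP[k' /andP[ok' /eqP E]]] | ok]; last first.
  have ir' : i < r.+1 by lia.
  by exists (Ordinal ir'); apply/existsP; exists (Ordinal lk); rewrite /= ok eqxx.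
have ii' : i = i'.
  apply: (dec_edges_disjoint dec (f := edg (P i) k)); first by lia.
  - by rewrite -ltnS.
  - by apply/edgesP; exists k.
  - by apply/edgesP; exists (k' : nat).
case: i' ii' k' ok' E => i' ri' /= <- k' ok' /(ear_edg_inj ear lk (ltn_ord k')) ->.
exact: ok'.
Qed.

Lemma card_alternating_subwalk i a b : 0 < i <= r -> a <= b <= wlength (P i) ->
  #|subwalk_edges (P i) a b :&: J| = b./2 - a./2.
Proof.
move=> ir /andP[ab lb]; have ear := dec_ear dec ir.
have -> : subwalk_edges (P i) a b :&: J = [set f in subwalk_edges (P i) a b | f \in J].
  by apply/setP => f; rewrite in_setI in_set.
rewrite (card_subwalk a (mem J) ear lb).
have -> : b./2 - a./2 = \sum_(a <= k < b) (odd k : nat).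
  by rewrite -!sum_odd (@big_cat_nat _ _ _ a 0 b) //= addKn.
by apply: eq_big_nat => k lk; rewrite /= edg_alternating //; lia.
Qed.

Lemma alternating_join_sub : J \subset graph_edges e.
Proof.
apply/subsetP => f; rewrite inE => /existsP[i /existsP[k /andP[_ /eqP ->]]].
apply: (subsetP (dec_edges_sub dec (_ : i <= r))); first by rewrite -ltnS.
by apply/edgesP; exists (k : nat).
Qed.

Lemma card_alternating_join : #|J| = \sum_(1 <= i < r.+1) (wlength (P i))./2.
Proof.
rewrite (card_dec dec alternating_join_sub); apply: eq_big_nat => i ir.
by rewrite setIC edgesE card_alternating_subwalk // ?subn0 //; lia.
Qed.

(** Earlier walks miss this inner vertex, and a later ear could meet it only in an end, which is
    excluded for ears meeting [C]. Only two edges at the vertex can then lie in [C], and even degree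
    forces both or neither. *)
Lemma even_subgraph_consecutive (C : {set {set V}}) j k :
  C \subset graph_edges e -> even_subgraph C ->
  0 < j <= r -> 0 < k < wlength (P j) ->
  (forall l, 0 < l <= r -> j < l -> ~~ [disjoint C & edges (P l)] ->
     vtx (P j) k <> start (P l) /\ vtx (P j) k <> finish (P l)) ->
  (edg (P j) k.-1 \in C) = (edg (P j) k \in C).
Proof.
move=> CE Ceven jr lk noend; have ear := dec_ear dec jr.
case: k => // k /= in lk noend *.
set v := vtx (P j) k.+1 in noend.
have incident f : f \in C -> v \in f -> f = edg (P j) k \/ f = edg (P j) k.+1.
  move=> fC vf; have [l lr fl] := dec_edge_cover dec (subsetP CE _ fC).
  case/edgesP: (fl) => m lm fm.
  have vl : v \in vertices (P l).
    by move: vf; rewrite fm !inE => /orP[]/eqP ->; apply: mem_vtx; lia.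
  case: (ltngtP l j) => [lj|jl|lj].
  - by move: (dec_inner (k := k.+1) dec jr lj lk); rewrite vl.
  - have [|ns nf] := noend l lr jl.
      by apply/negP => /disjointFr/(_ fC); rewrite fl.
    case/vtxP: vl => k' lk' vk'.
    have k'in : 0 < k' < wlength (P l).
      suff: ~ (k' = 0 \/ k' = wlength (P l)) by lia.
      by move=> [] k'E; move: vk'; rewrite k'E ?vtx_wlength.
    have := dec_inner dec lr jl k'in; rewrite -vk' mem_vtx //; lia.
  - move: vf; rewrite fm lj in lm * => {lr fl vl}; rewrite !inE => /orP[]/eqP E.
      by right; rewrite (inner_vtx_inj (k := k.+1) ear lk _ E) //; lia.
    by left; have [->] := inner_vtx_inj (k := k.+1) ear lk lm E.
have ne : edg (P j) k != edg (P j) k.+1.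
  by apply/eqP => /(ear_edg_inj ear); lia.
have := Ceven v; rewrite /odd_degree.
have -> : [set f in C | v \in f] = C :&: [set edg (P j) k; edg (P j) k.+1].
  apply/setP => f; rewrite in_set in_setI in_set2; case fC: (f \in C) => //=.
  apply/idP/idP => [/(incident _ fC)[] -> | /orP[]/eqP ->]; rewrite ?eqxx ?orbT //.
    exact: set22.
  exact: set21.
rewrite setIUr cardsU.
have set1I (g : {set V}) : #|C :&: [set g]| = (g \in C).
  case gC: (g \in C); first by rewrite (setIidPr _) ?cards1 // sub1set.
  by apply/eqP; rewrite cards_eq0 setI_eq0 disjoint_sym disjoints1 gC.
rewrite !set1I (_ : _ :&: _ = set0) ?cards0; last first.
  apply/setP => f; rewrite in_setI !in_setI !in_set1 in_set0; apply/negP.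
  by case/andP => /andP[_ /eqP ->] /andP[_]; apply/negP.
by case: (_ \in C); case: (_ \in C).
Qed.

Lemma subwalk_constant (C : {set {set V}}) q a b : b <= wlength q ->
  (forall k, a < k < b -> (edg q k.-1 \in C) = (edg q k \in C)) ->
  [disjoint C & subwalk_edges q a b] \/ subwalk_edges q a b \subset C.
Proof.
move=> lb step.
have const n : a + n < b -> (edg q (a + n) \in C) = (edg q a \in C).
  elim: n => [|n IH] lan; first by rewrite addn0.
  by rewrite -IH -?(step (a + n.+1)) ?addnS //; lia.
case aC: (edg q a \in C); [right|left].
  apply/subsetP => f /(subwalk_edgesP _ _ lb)[k lk ->].
  by rewrite -(@subnKC a k) ?const //; lia.
rewrite disjoint_sym disjoints_subset; apply/subsetP => f /(subwalk_edgesP _ _ lb)[k lk ->].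
by rewrite in_setC -(@subnKC a k) ?const ?aC //; lia.
Qed.

Lemma alternating_join_conservative (C : {set {set V}}) :
  C \subset graph_edges e -> even_subgraph C -> (#|C :&: J|).*2 <= #|C|.
Proof.
case: nest => _ parent [I [Iint Ilam]].
(* A parent is fixed for every ear; outside the range the value 0 is a dummy. *)
have {parent} /choice[p pP] : forall i, exists j,
    0 < i <= r -> j < i /\ nested_in (P i) (P j).
  move=> i; case: (boolP (0 < i <= r)) => ir; last by exists 0.
  by have [j ji ni] := parent i ir; exists j.
pose used (C : {set {set V}}) i := ~~ [disjoint C & edges (P i)].
(* Exchanging an ear for part of an earlier one decreases this weight. *)
pose weight C := \sum_(i < r.+1 | used C i) 2 ^ i.
have [n] := ubnP (weight C); elim: n C => // n IH C wC CE Ceven.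
have used_pos l : used C l -> 0 < l.
  by rewrite lt0n; apply: contraNneq => ->; rewrite (dec_edges0 dec) -setI_eq0 setI0.
case: (set_0Vmem C) => [-> | [f0 f0C]]; first by rewrite set0I !cards0.
have [i0 i0r f0i] := dec_edge_cover dec (subsetP CE _ f0C).
have i0r' : i0 < r.+1 by lia.
have Ui0 : used C (Ordinal i0r') by apply/negP => /disjointFr/(_ f0C); rewrite f0i.
(* The maximal parent keeps ends of used ears out of the interior of the chosen ear; the minimal
   interval, chosen next, keeps them out of the interior of that interval. *)
case: (@arg_maxnP _ (Ordinal i0r') (fun l : 'I_r.+1 => used C l) (fun l => p l) Ui0)
  => i1 Ui1 max_p {f0 f0C i0 i0r f0i i0r' Ui0}.
have Qi1 : used C i1 && (p i1 == p i1) by rewrite Ui1 eqxx.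
case: (@arg_minnP _ i1 (fun l : 'I_r.+1 => used C l && (p l == p i1))
  (fun l => #|I l (p i1)|) Qi1) => i /andP[Ui /eqP pi] min_I.
have {max_p} max_p l : 0 < l <= r -> used C l -> p l <= p i.
  move=> lr Ul; have lr' : l < r.+1 by lia.
  by rewrite pi; apply: (max_p (Ordinal lr')).
have {min_I} min_I l : 0 < l <= r -> used C l -> p l = p i -> #|I i (p i)| <= #|I l (p i)|.
  move=> lr Ul pl; have lr' : l < r.+1 by lia.
  by rewrite pi; apply: (min_I (Ordinal lr')); rewrite /= pl pi Ul eqxx.
have ir : 0 < i <= r by rewrite -[_ <= r]ltnS ltn_ord used_pos.
move: (nat_of_ord i) ir Ui max_p min_I => {i1 Ui1 Qi1 pi} {}i ir Ui max_p min_I.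
have ear := dec_ear dec ir.
have [ji nij] := pP i ir; set j := p i in ji nij max_p min_I.
have jr : j <= r by lia.
(* The parent of [P l] contains both ends of [P l], and no walk before [P k] contains an inner
   vertex of [P k]. *)
have parent_ge k m l : 0 < k <= r -> 0 < m < wlength (P k) -> 0 < l <= r ->
    vtx (P k) m = start (P l) \/ vtx (P k) m = finish (P l) -> k <= p l.
  move=> kr lm lr ends; rewrite leqNgt; apply/negP => /(dec_inner dec kr)/(_ lm).
  by have [_ /andP[sl fl]] := pP l lr; case: ends => ->; rewrite ?sl ?fl.
(* A used ear ending inside [P i] would have a parent of index at least [i > j], against maximality.
   So [C] contains all or none of [P i], and [P i] is used. *)
have PiC : edges (P i) \subset C.
  rewrite edgesE; case: (@subwalk_constant C (P i) 0 (wlength (P i))) => //.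
    move=> k lk; apply: even_subgraph_consecutive => // l lr il Ul.
    split=> E; suff: i <= j by [lia]; apply: leq_trans (max_p l lr Ul);
      apply: (parent_ge _ k) => //; [by left|by right].
  by rewrite -edgesE => dis; case/negP: Ui.
have [a [b /= [/andP[ab lb] abE Iab]]] := Iint i j ir jr nij.
rewrite -!/(vtx _ _) in abE.
have root_ab : j = 0 -> a = b.
  have w0 : wlength (P 0) = 0 by case: dec.
  by move=> j0; move: lb ab; rewrite j0 w0 leqn0 => /eqP ->; rewrite leqn0 => /eqP.
(* A used later ear ending strictly inside the interval must have parent [j]. Its own interval is at
   least as long, so the two intervals cross, against nestedness. *)
have IC : 0 < j -> [disjoint C & subwalk_edges (P j) a b] \/ subwalk_edges (P j) a b \subset C.
  move=> j_gt0; have {}jr : 0 < j <= r by lia.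
  have earj := dec_ear dec jr.
  apply: subwalk_constant => // k lk; apply: even_subgraph_consecutive => //; first by lia.
  move=> l lr jl Ul; apply/not_orP => ends.
  have kin : 0 < k < wlength (P j) by clear -lk lb; lia.
  have plj : p l = j.
    by apply/eqP; rewrite eqn_leq max_p // (parent_ge j k l).
  have [_ nlj] := pP l lr; rewrite plj in nlj.
  have [c [d /= [/andP[cd ld] cdE Icd]]] := Iint l j lr (proj2 (andP jr)) nlj.
  have := min_I l lr Ul plj; rewrite Iab Icd !(card_subwalk_edges _ earj) // => le.
  have := Ilam i l j ir lr (proj2 (andP jr)) nij nlj; rewrite Iab Icd.
  apply: (subwalks_cross earj lk lb _ le); first by rewrite cd.
  by case: cdE ends => -[<- <-] [] E; [left|right|right|left]; exact: E.
(* The root is not an ear, so the facts on intervals are proved separately for it; there the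
   interval is empty. *)
have swP : [/\ [disjoint C & subwalk_edges (P j) a b] \/ subwalk_edges (P j) a b \subset C,
    #|subwalk_edges (P j) a b| = b - a,
    #|subwalk_edges (P j) a b :&: J| = b./2 - a./2 &
    forall v, odd_degree (subwalk_edges (P j) a b) v = (v == vtx (P j) a) (+) (v == vtx (P j) b)].
  case: (posnP j) => [/root_ab{}ab | j_gt0].
    have -> : subwalk_edges (P j) a b = set0.
      apply/setP => f; rewrite in_set0; apply/negP => /(subwalk_edgesP _ _ lb)[k].
      by rewrite ab; case: ltngtP.
    rewrite set0I cards0 ab !subnn; split=> //; first by right; apply: sub0set.
    by move=> v; rewrite addbb odd_degree0.
  have {}jr : 0 < j <= r by rewrite j_gt0.
  have earj := dec_ear dec jr.
  split; last 1 first.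
  - by move=> v; rewrite (odd_degree_subwalk _ earj) ?ab.
  - exact: IC.
  - by rewrite (card_subwalk_edges _ earj).
  - by rewrite card_alternating_subwalk ?ab.
case: swP => {}IC cI cIJ dI.
have par : odd (b - a) = odd (wlength (P i)).
  have [c bipc] := bip.
  rewrite -[wlength (P i)]subn0 (bip_parity (a := 0) bipc ear) ?leqnn // vtx0 vtx_wlength.
  suff -> : odd (b - a) = c (vtx (P j) a) (+) c (vtx (P j) b).
    by case: abE => -[-> ->] //; rewrite addbC.
  case: (posnP j) => [/root_ab -> | j_gt0]; first by rewrite subnn addbb.
  by apply: (bip_parity bipc (dec_ear dec _)); rewrite ?ab ?j_gt0.
set B := subwalk_edges (P j) a b in IC cI cIJ dI.
pose D := symdiff C (symdiff (edges (P i)) B).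
have BP : B \subset edges (P j) := subwalk_edges_sub _ _ _.
have ij : i != j by rewrite neq_ltn ji orbT.
have AB : [disjoint edges (P i) & B].
  rewrite -setI_eq0 -subset0 -(dec_edges_setI0 dec (proj2 (andP ir)) jr ij).
  exact: setIS.
have Dle : (#|D :&: J|).*2 <= #|D|.
  apply: IH.
  - rewrite -ltnS; apply: leq_trans wC; rewrite ltnS.
    have ijr : j < i <= r by rewrite ji; case/andP: ir.
    apply: sum_expn2_lt ijr Ui _ _.
      rewrite negbK -setI_eq0 !symdiffIl setIid (setIC B) (disjoint_setI0 AB) symdiff0.
      by rewrite (setIidPr PiC) symdiffxx.
    move=> l lr li lj; apply: contraNN; rewrite -!setI_eq0 !symdiffIl.
    rewrite (dec_edges_setI0 dec (proj2 (andP ir)) lr); last by rewrite eq_sym.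
    suff -> : B :&: edges (P l) = set0 by rewrite !symdiff0.
    apply/eqP; rewrite -subset0 -(dec_edges_setI0 dec jr lr); last by rewrite eq_sym.
    exact: setSI.
  - apply/subsetP => f; rewrite !in_symdiff.
    case fC: (f \in C) => /=; first by rewrite (subsetP CE).
    case fi: (f \in edges _); first by rewrite (subsetP PiC) in fC.
    by move=> /(subsetP BP); apply/subsetP/(dec_edges_sub dec jr).
  - move=> v; rewrite !odd_degree_symdiff Ceven dI edgesE (odd_degree_subwalk _ ear) ?leqnn //.
    rewrite vtx0 vtx_wlength; case: abE => -[-> ->]; by do ! case: (_ == _).
have [exT subT] := card_exchange setT PiC AB.
have [exJ subJ] := card_exchange J PiC AB.
rewrite -/D !setIT in exT subT; rewrite -/D in exJ subJ.
have cA : #|edges (P i)| = wlength (P i).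
  by rewrite edgesE (card_subwalk_edges _ ear) ?subn0.
have cAJ : #|edges (P i) :&: J| = (wlength (P i))./2.
  by rewrite edgesE card_alternating_subwalk ?leqnn ?subn0.
have [le1 le2] := half_subn_bounds ab par.
(* In both cases white minus black of [D] is at most that of [C], and it is nonnegative for [D]. *)
case: IC => [dis | sub].
  move: Dle (exT dis) (exJ dis); rewrite cA cAJ cI cIJ; clear -le1 le2.
  move: #|D| #|D :&: J| #|C| #|C :&: J| => *; lia.
move: Dle (subT sub) (subJ sub); rewrite cA cAJ cI cIJ; clear -le1 le2.
move: #|D| #|D :&: J| #|C| #|C :&: J| => *; lia.
Qed.

End NestedEarDecompositions.

Theorem corollary4p12 (V : finType) (e : rel V)
  (e_sym : symmetric e) (e_irr : irreflexive e)
  (e_bip : bipartite e) (e_noiso : no_isolated_vertex e)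
  (e_nested : exists (r : nat) (P : nat -> walk V),
     nested_ear_decomposition e r P) :
  forall (r : nat) (P : nat -> walk V),
    nested_ear_decomposition e r P -> even_ears r P = phi e.
Proof.
move=> r P nest; have [dec _ _] := nest.
(* The given decomposition rules out the default value 0 of [phi]. *)
rewrite /phi; case: pselect => [h|[]]; last first.
  by exists (even_ears r P); apply/asboolP; exists r, P.
case: ex_minnP => m /asboolP[r' [P' [dec' <-]]] min_m.
apply/eqP; rewrite eqn_leq min_m ?andbT; last by apply/asboolP; exists r, P.
(* The black edges of the nested [P] are tested against the minimizer [P']; this compares the two
   sums of half lengths, which determine the numbers of even ears. *)
have := card_join_le dec' (alternating_join_sub nest)
  (alternating_join_conservative e_bip nest).
rewrite (card_alternating_join nest) => le_J.
have := sum_wlength_even_ears dec e_irr e_noiso.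
have := sum_wlength_even_ears dec' e_irr e_noiso.
lia.
Qed.
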